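(* Let $\mathcal{F}$ be a commutative perfect semi-field of characteristic $1$ (satisfying the standing assumptions in the context) which is complete for an F-norm $\|\cdot\|$. Let $X\in\mathcal{F}\setminus\{0\}$. Then there exists $\phi\in S_E(\mathcal{F})$ such that $|\phi(X)|=r(X)$.
   Context: A commutative perfect semi-field of characteristic $1$ is a triple $(\mathcal{F},\oplus,+)$ where: $\oplus$ is a commutative associative law with $X\oplus X=X$ for all $X$; $(\mathcal{F},+)$ is an abelian group with identity $0$ and $X+(Y\oplus Z)=(X+Y)\oplus(X+Z)$ for all $X,Y,Z$; for every integer $n\ge 1$ the map $X\mapsto nX$ is surjective (it is then bijective, and $(\mathcal F,+)$ is naturally a $\mathbb{Q}$-vector space). Partial order: $X\le Y$ iff $X\oplus Y=Y$. Standing assumptions: $\mathcal{F}\neq\{0\}$; there is a fixed $E\in\mathcal{F}$ such that for every $X\in\mathcal{F}$ there is $t\in\mathbb{Q}^+$ (non-negative rationals) with $-tE\le X\le tE$; $r(X)\in\mathbb{R}^+$ denotes the infimum of all such $t$; and $r(X)=0$ if and only if $X=0$. An F-norm on $\mathcal{F}$ is a map $\|\cdot\|:\mathcal{F}\to\mathbb{R}^+$ such that for all $t\in\mathbb{Q}$ and $X,Y,X',Y'\in\mathcal{F}$: $\|tX\|=|t|\,\|X\|$, $\|X+Y\|\le\|X\|+\|Y\|$, $r(X)\le\|X\|$, and $\|X\oplus Y-X'\oplus Y'\|\le\max(\|X-X'\|,\|Y-Y'\|)$. Complete means complete for the distance $\|X-Y\|$. A character of $\mathcal{F}$ is a map $\phi:\mathcal{F}\to\mathbb{R}$,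 not identically zero, with $\phi(X\oplus Y)=\max(\phi(X),\phi(Y))$ and $\phi(X+Y)=\phi(X)+\phi(Y)$ for all $X,Y$. $S_E(\mathcal{F})$ is the set of characters with $\phi(E)=1$. *)

(* Defs.v *)
From HB Require Import structures.
From mathcomp Require Import all_boot all_order all_algebra.
From mathcomp Require Import all_classical all_reals.

Set Implicit Arguments.
Unset Strict Implicit.
Unset Printing Implicit Defensive.

Import Order.TTheory GRing.Theory Num.Theory.

Local Open Scope ring_scope.
Local Open Scope classical_set_scope.

Reserved Notation "x ⊕ y" (at level 50, left associativity).

(* As in tropical algebra, the "multiplication" of the semi-field is written
   + (it is the law of the zmodType) and its idempotent "addition" ⊕. *)
HB.mixin Record Zmodule_isPerfectSemifield F of GRing.Zmodule F := {
  oplus : F -> F -> F;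
  oplusC : commutative oplus;
  oplusA : associative oplus;
  oplusxx : idempotent_op oplus;
  addr_oplusr : right_distributive +%R oplus;
  mulrn_surj : forall n : nat, (0 < n)%N ->
    forall y : F, exists x : F, x *+ n = y
}.

#[short(type="perfectSemifieldType")]
HB.structure Definition PerfectSemifield :=
  { F of GRing.Zmodule F & Zmodule_isPerfectSemifield F }.

Notation "x ⊕ y" := (oplus x y) : ring_scope.

Section Order.
Variable F : perfectSemifieldType.
Implicit Types x y z : F.

(* Order induced by ⊕, so that ⊕ is its join; lives in order_scope (%O). *)
Let le x y := x ⊕ y == y.

Let le_refl : reflexive le. Proof. by move=> x; rewrite /le oplusxx. Qed.

Let le_anti : antisymmetric le.
Proof. by move=> x y /andP[/eqP xy /eqP yx]; rewrite -xy oplusC yx. Qed.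

Let le_trans : transitive le.
Proof.
by move=> y x z /eqP xy /eqP yz; rewrite /le -yz oplusA xy.
Qed.

#[non_forgetful_inheritance]
HB.instance Definition _ :=
  Order.Le_isPOrder.Build Order.default_display (PerfectSemifield.sort F)
    le_refl le_anti le_trans.

Let oplus_le x y z : (x ⊕ y <= z)%O = (x <= z)%O && (y <= z)%O.
Proof.
apply/eqP/andP => [xyz|[/eqP xz /eqP yz]]; last by rewrite -oplusA yz xz.
split; apply/eqP; rewrite -xyz; first by rewrite !oplusA oplusxx.
by rewrite (oplusC x) !oplusA oplusxx.
Qed.

#[non_forgetful_inheritance]
HB.instance Definition _ :=
  Order.POrder_isJoinSemilattice.Build Order.default_display
    (PerfectSemifield.sort F) oplus_le.

Lemma leEoplus x y : (x <= y)%O = (x ⊕ y == y).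
Proof. by []. Qed.

Lemma joinEoplus x y : (x `|` y)%O = x ⊕ y.
Proof. by []. Qed.

End Order.

Section RationalScaling.
Variable F : perfectSemifieldType.
Implicit Types (x y : F) (a b : rat) (n : nat) (m d : int).

Lemma mulrn_eq0_oplus n x : (0 < n)%N -> x *+ n = 0 -> x = 0.
Proof.
case: n => // n _ xn0.
pose s := fix s k := if k is k'.+1 then s k' ⊕ x *+ k else 0.
have xs k : x + s k ⊕ 0 = s k.+1.
  elim: k => [|k IHk]; first by rewrite /= addr0 mulr1n oplusC.
  by rewrite [s k.+1]/= addr_oplusr -mulrS -oplusA [_ ⊕ 0]oplusC oplusA IHk.
have s_top : s n ⊕ x *+ n = s n.
  by case: (n) => [|k] /=; rewrite -?oplusA oplusxx.
have xsn : x + s n = s n.+1 by rewrite -xs -xn0 mulrS -addr_oplusr s_top.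
have s_ge0 k : s k ⊕ 0 = s k.
  elim: k => [|k IHk] /=; first by rewrite oplusxx.
  by rewrite -oplusA [_ ⊕ 0]oplusC oplusA IHk.
have sSn : s n.+1 = s n by rewrite [LHS]/= xn0 s_ge0.
by apply: (@addIr _ (s n)); rewrite add0r xsn sSn.
Qed.

Lemma mulrIz_oplus d x y : d != 0 -> x *~ d = y *~ d -> x = y.
Proof.
move=> d_neq0 /eqP; rewrite -subr_eq0 -mulrzBl => /eqP xy0.
apply/eqP; rewrite -subr_eq0; apply/eqP.
apply: (@mulrn_eq0_oplus `|d|%N); first by rewrite absz_gt0.
by rewrite pmulrn abszEsg mulrC mulrzA xy0 mul0rz.
Qed.

Let div_ex a x : exists y, y *~ denq a == x *~ numq a.
Proof.
have d_gt0 : (0 < `|denq a|)%N by rewrite absz_gt0 denq_neq0.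
have [y yE] := mulrn_surj _ d_gt0 (x *~ numq a); exists y.
by rewrite -(gtz0_abs (denq_gt0 a)) -pmulrn yE.
Qed.

(* The unique y such that d y = m x, where a = m / d in lowest terms. *)
Definition qscale a x : F := xchoose (div_ex a x).

Lemma qscale_den a x : qscale a x *~ denq a = x *~ numq a.
Proof. exact/eqP/(xchooseP (div_ex a x)). Qed.

Lemma qscale_frac a m d x y : d != 0 -> a * d%:~R = m%:~R ->
  y *~ d = x *~ m -> qscale a x = y.
Proof.
move=> d_neq0 aE yE; apply: (mulrIz_oplus (mulf_neq0 d_neq0 (denq_neq0 a))).
have nE : numq a * d = m * denq a.
  by apply: (intr_inj (R := rat)); rewrite !intrM numqE -aE mulrAC.
by rewrite [in LHS]mulrC mulrzA qscale_den -mulrzA nE [RHS]mulrzA yE -mulrzA.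
Qed.

Let qscaleA a b x : qscale a (qscale b x) = qscale (a * b) x.
Proof.
symmetry; apply: (@qscale_frac _ (numq a * numq b) (denq a * denq b)).
- by rewrite mulf_neq0 ?denq_neq0.
- by rewrite !intrM !numqE mulrACA.
- by rewrite mulrzA qscale_den mulrzAC qscale_den -mulrzA [in LHS]mulrC.
Qed.

Let qscale1 : left_id 1 qscale.
Proof. by move=> x; apply: (@qscale_frac _ 1 1). Qed.

Let qscaleDr : right_distributive qscale +%R.
Proof.
move=> a x y; apply: (@qscale_frac _ (numq a) (denq a)).
- exact: denq_neq0.
- by rewrite numqE.
- by rewrite !mulrzDl !qscale_den.
Qed.

Let qscaleDl x : {morph qscale^~ x : a b / a + b}.
Proof.
move=> a b.
apply: (@qscale_frac _ (numq a * denq b + numq b * denq a) (denq a * denq b)).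
- by rewrite mulf_neq0 ?denq_neq0.
- rewrite intrD !intrM !numqE mulrDl mulrA.
  by congr (_ + _); rewrite mulrCA mulrC.
- rewrite mulrzDl mulrzDr !mulrzA qscale_den.
  by rewrite -[qscale b x *~ _ *~ _]mulrzA mulrC mulrzA qscale_den.
Qed.

#[non_forgetful_inheritance]
HB.instance Definition _ := GRing.Zmodule_isLmodule.Build rat
  (PerfectSemifield.sort F) qscaleA qscale1 qscaleDr qscaleDl.

Lemma scale_denq a x : (a *: x) *~ denq a = x *~ numq a.
Proof. exact: qscale_den. Qed.

End RationalScaling.

Section Characters.
Variables (R : realType) (F : perfectSemifieldType).
Implicit Types (E X Y : F) (t : rat) (N : F -> R).

Definition dominates E X : set rat :=
  [set t | 0 <= t /\ (- (t *: E) <= X <= t *: E)%O].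

(* r(X); inf is junk on the empty set, so this is only meaningful when
   dominates E X is nonempty. *)
Definition radius E X : R := inf [set ratr t | t in dominates E X].

Record is_Fnorm E N : Prop := {
  Fnorm_ge0 : forall X, 0 <= N X;
  FnormZ : forall t X, N (t *: X) = `|ratr t| * N X;
  ler_FnormD : forall X Y, N (X + Y) <= N X + N Y;
  radius_le_Fnorm : forall X, radius E X <= N X;
  Fnorm_oplus_contract : forall X Y X' Y',
    N (X ⊕ Y - (X' ⊕ Y')) <= Num.max (N (X - X')) (N (Y - Y'))
}.

Definition Fnorm_cauchy N (u : nat -> F) : Prop :=
  forall e : R, 0 < e -> exists k : nat,
    forall m n : nat, (k <= m)%N -> (k <= n)%N -> N (u m - u n) < e.

Definition Fnorm_cvg N (u : nat -> F) (l : F) : Prop :=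
  forall e : R, 0 < e -> exists k : nat,
    forall n : nat, (k <= n)%N -> N (u n - l) < e.

Definition Fnorm_complete N : Prop :=
  forall u : nat -> F, Fnorm_cauchy N u -> exists l : F, Fnorm_cvg N u l.

Record is_character (phi : F -> R) : Prop := {
  character_neq0 : exists X, phi X != 0;
  character_oplus : forall X Y, phi (X ⊕ Y) = Num.max (phi X) (phi Y);
  characterD : forall X Y, phi (X + Y) = phi X + phi Y
}.

(* The set S_E(F) of characters normalised at E. *)
Definition normalized_characters E : set (F -> R) :=
  [set phi | is_character phi /\ phi E = 1].

End Characters.

Arguments radius R {F}.
Arguments normalized_characters R {F}.

(* Main.v *)
Require Import Defs.
From mathcomp Require Import all_boot all_order all_algebra.
From mathcomp Require Import all_classical all_reals.

Set Implicit Arguments.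
Unset Strict Implicit.

Import Order.TTheory GRing.Theory Num.Theory.

Local Open Scope ring_scope.
Local Open Scope classical_set_scope.

(** Idea: call q : F -> R max-sublinear if it is subadditive, turns ⊕ into max
    and commutes with positive integer multiples; the typical example is the
    gauge p(Y) = inf {t | Y <= tE}, and r(X) = max(p(X), p(-X)).  Given Z, the
    functional q_Z(Y) = inf_n (q(Y + nZ) - n q(Z)) is max-sublinear, is at
    most q, and satisfies q_Z(Z) = q(Z) = - q_Z(-Z).  (If F is a space of
    functions and q the maximum over a closed set, q_Z is the maximum over the
    face where Z is maximal.)  A minimal max-sublinear q <= p_X, which exists
    by Zorn's lemma, satisfies q_Z = q for all Z, so it is odd, hence additive,
    and q(X) = p(X). *)

(** * The translation-invariant order and its compatibility with rational scaling *)

Section SemifieldOrder.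
Context {F : perfectSemifieldType}.
Implicit Types (x y z E : F) (a b : rat).

Lemma oplus_leD2l z x y : (z + x <= z + y)%O = (x <= y)%O.
Proof. by rewrite !leEoplus -addr_oplusr (inj_eq (addrI z)). Qed.

Lemma oplus_leD2r z x y : (x + z <= y + z)%O = (x <= y)%O.
Proof. by rewrite ![_ + z]addrC oplus_leD2l. Qed.

Lemma oplus_leD {x y x' y'} :
  (x <= y)%O -> (x' <= y')%O -> (x + x' <= y + y')%O.
Proof.
by move=> xy xy'; apply: (@le_trans _ _ (y + x'));
   rewrite ?oplus_leD2r ?oplus_leD2l.
Qed.

Lemma oplus_subr_ge0 x y : ((0 : F) <= y - x)%O = (x <= y)%O.
Proof. by rewrite -(oplus_leD2r x) subrK add0r. Qed.

Lemma oplus_leN2 x y : (- x <= - y)%O = (y <= x)%O.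
Proof. by rewrite -oplus_subr_ge0 opprK addrC oplus_subr_ge0. Qed.

Lemma oplus_mulrn_ge0 {n x} : ((0 : F) <= x)%O -> ((0 : F) <= x *+ n)%O.
Proof.
move=> x0; elim: n => [|n IHn]; first by rewrite mulr0n.
by rewrite mulrS -[0]addr0 oplus_leD.
Qed.

Lemma oplus_mulrn_ge0_inv {n x} :
  (0 < n)%N -> ((0 : F) <= x *+ n)%O -> ((0 : F) <= x)%O.
Proof.
case: n => // n _ xn0.
pose s := fix s k := if k is k'.+1 then s k' ⊕ x *+ k else 0.
have xs k : x + s k ⊕ 0 = s k.+1.
  elim: k => [|k IHk]; first by rewrite /= addr0 mulr1n oplusC.
  by rewrite [s k.+1]/= addr_oplusr -mulrS -oplusA [_ ⊕ 0]oplusC oplusA IHk.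
have s_ge k : (x *+ k <= s k)%O.
  by case: k => [|k]; rewrite leEoplus ?oplusxx //= oplusC -oplusA oplusxx.
(* With n in place of k, the term 0 in [xs] is absorbed since 0 <= (n+1)x. *)
have xsn : x + s n = s n.+1.
  have : ((0 : F) <= x + s n)%O.
    by apply: le_trans xn0 _; rewrite mulrS oplus_leD2l.
  by rewrite leEoplus oplusC xs => /eqP.
rewrite -(oplus_leD2r (s n)) add0r xsn leEoplus /= oplusA oplusxx.
exact: eqxx.
Qed.

Lemma oplus_scale_ge0 {a x} :
  0 <= a -> ((0 : F) <= x)%O -> ((0 : F) <= a *: x)%O.
Proof.
move=> a0 x0; apply: (@oplus_mulrn_ge0_inv `|denq a|%N).
  by rewrite absz_gt0 denq_neq0.
rewrite pmulrn gtz0_abs ?denq_gt0 // scale_denq.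
have : 0 <= numq a by rewrite numq_ge0.
by case: (numq a) => // n _; exact: oplus_mulrn_ge0.
Qed.

Lemma oplus_ler_wpZ2l {a x y} : 0 <= a -> (x <= y)%O -> (a *: x <= a *: y)%O.
Proof.
move=> a0; rewrite -oplus_subr_ge0 -(oplus_subr_ge0 (a *: x)) -scalerBr.
exact: oplus_scale_ge0.
Qed.

Lemma oplus_ler_wpZ2r {a b E} :
  ((0 : F) <= E)%O -> a <= b -> (a *: E <= b *: E)%O.
Proof.
move=> E0 ab; rewrite -oplus_subr_ge0 -scalerBl.
by apply: oplus_scale_ge0 => //; rewrite subr_ge0.
Qed.

Lemma oplus_scale_le_inv {a b E} : ((0 : F) <= E)%O -> E != 0 ->
  (a *: E <= b *: E)%O -> a <= b.
Proof.
move=> E0 En0 abE; rewrite leNgt; apply/negP => ba.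
have : a *: E = b *: E.
  by apply/eqP; rewrite eq_le abE oplus_ler_wpZ2r // ltW.
move/eqP; rewrite -subr_eq0 -scalerBl scaler_eq0 subr_eq0 (negPf En0) orbF.
by rewrite gt_eqF.
Qed.

End SemifieldOrder.

(** * Max-sublinear functionals, their faces and minimal elements *)

Section MaxSublinear.
Context {R : realType} {F : perfectSemifieldType}.
Implicit Types (x y z : F) (n : nat) (p q f g h : F -> R) (A : set (F -> R)).

Record max_sublinear q : Prop := {
  maxsub_oplus : forall x y, q (x ⊕ y) = Num.max (q x) (q y);
  maxsubD : forall x y, q (x + y) <= q x + q y;
  maxsubMn : forall n x, q (x *+ n.+1) = q x *+ n.+1
}.

Definition pointwise_inf A x : R := inf [set f x | f in A].

Lemma pointwise_inf_le A f x :
  has_lbound [set g x | g in A] -> A f -> pointwise_inf A x <= f x.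
Proof. by move=> lbA Af; apply: ge_inf => //; exists f. Qed.

Lemma le_pointwise_inf A c x :
  A !=set0 -> (forall f, A f -> c <= f x) -> c <= pointwise_inf A x.
Proof.
move=> [f Af] cA; apply: lb_le_inf; first by exists (f x), f.
by move=> _ [g Ag <-]; exact: cA.
Qed.

Lemma pointwise_inf_adherent A x (e : R) : A !=set0 -> 0 < e ->
  exists2 f, A f & f x < pointwise_inf A x + e.
Proof.
move=> [f Af] e0; have [||_ [g Ag <-] lt_g] :=
  @inf_lt R [set f x | f in A] (pointwise_inf A x + e).
- by exists (f x), f.
- by rewrite ltrDl.
- by exists g.
Qed.

(** Serves both for faces and for chains in Zorn's lemma. Members of a face family are neither
    subadditive nor homogeneous one by one, so these two conditions are only asked up to a change of
    member. *)
Lemma pointwise_inf_max_sublinear A : A !=set0 ->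
  (forall x, has_lbound [set f x | f in A]) ->
  (forall f g, A f -> A g ->
     exists2 h, A h & forall x, h x <= f x /\ h x <= g x) ->
  (forall f x y, A f -> f (x ⊕ y) = Num.max (f x) (f y)) ->
  (forall f g x y, A f -> A g -> exists2 h, A h & h (x + y) <= f x + g y) ->
  (forall h n x, A h -> exists2 f, A f & f x *+ n.+1 <= h (x *+ n.+1)) ->
  max_sublinear (pointwise_inf A).
Proof.
move=> A0 lbA dirA joinA addA homA; set q := pointwise_inf A.
have qD x y : q (x + y) <= q x + q y.
  apply/ler_addgt0Pr => e e0; have e20 : 0 < e / 2 by rewrite divr_gt0.
  have [f Af fx] := pointwise_inf_adherent x A0 e20.
  have [g Ag gy] := pointwise_inf_adherent y A0 e20.
  have [h Ah hxy] := addA f g x y Af Ag.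
  apply: le_trans (pointwise_inf_le (lbA _) Ah) _.
  apply: le_trans hxy _.
  by rewrite [e]splitr addrACA ltW // ltrD.
split=> // [x y|n x]; apply/eqP; rewrite eq_le.
- apply/andP; split; last first.
    rewrite ge_max; apply/andP; split; apply: le_pointwise_inf => // f Af;
    by rewrite joinA // le_max (pointwise_inf_le (lbA _) Af) ?orbT.
  (* Directedness yields a single h that is within e of the infimum at x and at y simultaneously. *)
  apply/ler_addgt0Pr => e e0.
  have [f Af fx] := pointwise_inf_adherent x A0 e0.
  have [g Ag gy] := pointwise_inf_adherent y A0 e0.
  have [h Ah hfg] := dirA f g Af Ag.
  apply: le_trans (pointwise_inf_le (lbA _) Ah) _.
  rewrite joinA // addr_maxl ge_max !le_max.
  by rewrite (le_trans (hfg x).1 (ltW fx)) (le_trans (hfg y).2 (ltW gy)) orbT.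
- apply/andP; split.
    elim: n => // n IHn; rewrite mulrS [leRHS]mulrS.
    by apply: le_trans (qD _ _) _; rewrite lerD2l.
  apply: le_pointwise_inf => // h Ah; have [f Af fh] := homA h n x Ah.
  by apply: le_trans fh; rewrite lerMn2r (pointwise_inf_le (lbA _) Af).
Qed.

Lemma maxsub0 {q} : max_sublinear q -> q 0 = 0.
Proof.
move=> qP; have := maxsubMn qP 1 0; rewrite mul0rn mulr2n => /eqP.
by rewrite -subr_eq0 opprD addrA subrr sub0r oppr_eq0 => /eqP.
Qed.

Lemma maxsubMn0 {q} n x : max_sublinear q -> q (x *+ n) = q x *+ n.
Proof.
move=> qP; case: n => [|n]; last exact: maxsubMn.
by rewrite !mulr0n maxsub0.
Qed.

Lemma maxsub_geN {q} x : max_sublinear q -> - q (- x) <= q x.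
Proof.
move=> qP; rewrite -subr_ge0 opprK.
by rewrite -(maxsub0 qP) -(subrr x) maxsubD.
Qed.

(** When q is a maximum over a set of points, the n-th member adds to x the penalty n(z - max z),
    which vanishes exactly on the face. The index 0 gives q itself; the index 1 takes the value - q
    z at - z. *)
Definition face_family q z : set (F -> R) :=
  [set (fun x => q (x + z *+ n) - q z *+ n) | n in [set: nat]].

Lemma face_family_nonincreasing q z x m n : max_sublinear q -> (m <= n)%N ->
  q (x + z *+ n) - q z *+ n <= q (x + z *+ m) - q z *+ m.
Proof.
move=> qP /subnKC <-; rewrite mulrnDr addrA (mulrnDr (q z)) opprD.
rewrite [- _ - _]addrC addrA lerD2r lerBlDr -(maxsubMn0 _ _ qP).
exact: maxsubD.
Qed.

(** Writing nz = (x + nz) + (- x) gives the bound - q (- x), independent of n. *)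
Lemma face_family_lbound q z x : max_sublinear q ->
  has_lbound [set f x | f in face_family q z].
Proof.
move=> qP; exists (- q (- x)) => _ [_ [n _ <-] <-].
rewrite lerBrDr addrC lerBlDr -(maxsubMn0 _ _ qP).
by rewrite -{1}[z *+ n](addKr x) addrC maxsubD.
Qed.

Definition face q z := pointwise_inf (face_family q z).

Lemma face_max_sublinear q z : max_sublinear q -> max_sublinear (face q z).
Proof.
move=> qP; apply: pointwise_inf_max_sublinear.
- by exists (fun x => q (x + z *+ 0) - q z *+ 0), 0%N.
- by move=> x; exact: face_family_lbound.
- move=> _ _ [m _ <-] [n _ <-].
  exists (fun x => q (x + z *+ maxn m n) - q z *+ maxn m n).
    by exists (maxn m n).
  by move=> x; split; apply: face_family_nonincreasing; rewrite // leq_max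
    leqnn ?orbT.
- move=> _ x y [n _ <-]; rewrite -addr_maxl -maxsub_oplus //.
  by rewrite [x ⊕ y + _]addrC addr_oplusr ![z *+ n + _]addrC.
- move=> _ _ x y [m _ <-] [n _ <-].
  exists (fun x => q (x + z *+ (m + n)) - q z *+ (m + n)).
    by exists (m + n)%N.
  rewrite addrACA -opprD -mulrnDr lerD2r mulrnDr addrACA.
  exact: maxsubD.
- move=> _ n x [m _ <-].
  exists (fun x => q (x + z *+ m) - q z *+ m); first by exists m.
  (* Multiplying the m-th member at x by n+1 gives the member of index m(n+1) at (n+1)x, which lies
     below the m-th one by monotonicity in the index. *)
  rewrite mulrnBl -maxsubMn // mulrnDl -!mulrnA.
  by apply: face_family_nonincreasing; rewrite // leq_pmulr.
Qed.

Lemma face_le q z x : max_sublinear q -> face q z x <= q x.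
Proof.
move=> qP; have -> : q x = q (x + z *+ 0) - q z *+ 0.
  by rewrite !mulr0n addr0 subr0.
apply: (@pointwise_inf_le (face_family q z)
  (fun x => q (x + z *+ 0) - q z *+ 0)).
  exact: face_family_lbound.
by exists 0%N.
Qed.

Lemma face_opp_le q z : max_sublinear q -> face q z (- z) <= - q z.
Proof.
move=> qP; have -> : - q z = q (- z + z *+ 1) - q z *+ 1.
  by rewrite !mulr1n addNr maxsub0 // sub0r.
apply: (@pointwise_inf_le (face_family q z)
  (fun x => q (x + z *+ 1) - q z *+ 1)).
  exact: face_family_lbound.
by exists 1%N.
Qed.

Lemma exists_minimal_max_sublinear p : max_sublinear p ->
  exists2 q, max_sublinear q & (forall x, q x <= p x) /\
    forall h, max_sublinear h -> (forall x, h x <= q x) ->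
      forall x, h x = q x.
Proof.
move=> pP.
pose T := {q | max_sublinear q /\ forall x, q x <= p x}.
pose p0 : T := exist _ p (conj pP (fun x => lexx (p x))).
(* The order is reversed, so that a maximal element for [S] is a minimal functional. *)
pose S (s t : T) := `[< forall x, sval t x <= sval s x >].
have [||C totC|[q [qP q_le_p]] q_min] := ZL_preorder p0 (R := S).
- by move=> s; apply/asboolP.
- move=> s r t /asboolP rs /asboolP st; apply/asboolP => x.
  exact: le_trans (st x) (rs x).
- have [[t0 Ct0]|C0] := pselect (C !=set0); last first.
    by exists p0 => s Cs; case: C0; exists s.
  pose A := [set sval t | t in C].
  have lbA x : has_lbound [set f x | f in A].
    (* Uniform over the chain: - p (- x) <= - f (- x) <= f x. *)
    exists (- p (- x)) => _ [_ [[f [fP fp]] _ <-] <-] /=.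
    by apply: le_trans (maxsub_geN _ fP); rewrite lerN2.
  have dirA f g : A f -> A g ->
      exists2 h, A h & forall x, h x <= f x /\ h x <= g x.
    move=> [s Cs <-] [t Ct <-].
    by have [/asboolP st|/asboolP ts] := totC s t Cs Ct;
      [exists (sval t) => [|x]; first exists t
      |exists (sval s) => [|x]; first exists s].
  have A0 : A !=set0 by exists (sval t0), t0.
  have AP : max_sublinear (pointwise_inf A).
    apply: pointwise_inf_max_sublinear => //.
    + by move=> _ x y [[f [fP fp]] _ <-]; exact: maxsub_oplus.
    + move=> f g x y Af Ag; have [h Ah hfg] := dirA f g Af Ag; exists h => //.
      have hP : max_sublinear h by case: Ah => [[? [? ?]]] _ <-.
      by apply: le_trans (maxsubD hP _ _) _; rewrite lerD ?(hfg _).1 ?(hfg _).2.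
    + move=> h n x Ah; exists h => //.
      by case: Ah => [[f [fP fp]]] _ <- /=; rewrite maxsubMn.
  have A_le x : pointwise_inf A x <= p x.
    apply: le_trans (@pointwise_inf_le A (sval t0) _ (lbA _) _) _.
      by exists t0.
    by case: (svalP t0).
  exists (exist _ (pointwise_inf A) (conj AP A_le) : T) => s Cs.
  apply/asboolP => x /=; by apply: pointwise_inf_le => //; exists s.
- exists q => //; split=> // h hP hq x; apply/eqP; rewrite eq_le hq /=.
  have hp y : h y <= p y by exact: le_trans (hq y) (q_le_p y).
  have := q_min (exist _ h (conj hP hp) : T).
  by move=> /(_ (asboolT hq)) /asboolP.
Qed.

Lemma exists_additive_minorant p z : max_sublinear p ->
  exists f, [/\ forall x y, f (x ⊕ y) = Num.max (f x) (f y),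
    forall x y, f (x + y) = f x + f y,
    forall x, f x <= p x & f z = p z].
Proof.
move=> pP.
have [q qP [qz q_min]] :=
  exists_minimal_max_sublinear (face_max_sublinear z pP).
(* By minimality q equals its own face at every x, and a face at x is at most - q x at - x. *)
have qN x : q (- x) = - q x.
  apply/eqP; rewrite eq_le; apply/andP; split.
    rewrite -(q_min _ (face_max_sublinear x qP)) ?face_opp_le // => y.
    exact: face_le.
  by have := maxsub_geN (- x) qP; rewrite opprK.
have qp x : q x <= p x by exact: le_trans (qz x) (face_le _ _ pP).
exists q; split=> // [x y|x y|].
- exact: maxsub_oplus.
(* Superadditivity: subadditivity applied to x = (x + y) + (- y), with oddness. *)
- apply/eqP; rewrite eq_le maxsubD //= -lerBrDr -qN.
  by rewrite -{1}[x](addrK y) maxsubD.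
(* Starting below [face p z] rather than below p is what forces equality at z: q (- z) <= - p z. *)
- apply/eqP; rewrite eq_le qp -lerN2 -qN.
  exact: le_trans (qz _) (face_opp_le _ pP).
Qed.

End MaxSublinear.

(** * The gauge of an order unit and its relation to the radius *)

Section Gauge.
Context {R : realType} {F : perfectSemifieldType}.
Implicit Types (E x y : F) (t : rat).

Definition order_unit E : Prop :=
  forall x, exists t, 0 <= t /\ (- (t *: E) <= x <= t *: E)%O.

Lemma order_unit_ge0 E : order_unit E -> ((0 : F) <= E)%O.
Proof.
move=> /(_ E) [t [t0 /andP[tE Et]]].
have E2 : ((0 : F) <= (2 * t) *: E)%O.
  rewrite mulrDl mul1r scalerDl -(subrr (t *: E)) oplus_leD2l.
  exact: le_trans tE Et.
have [t_eq0|t_neq0] := eqVneq t 0.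
  have -> : E = 0.
    by apply: le_anti; move: tE Et; rewrite t_eq0 scale0r oppr0 => -> ->.
  exact: lexx.
rewrite -[E](scalerK (a := 2 * t)) ?mulf_neq0 //.
by apply: oplus_scale_ge0; rewrite // invr_ge0 mulr_ge0.
Qed.

Lemma order_unit_neq0 E x : order_unit E -> x != 0 -> E != 0.
Proof.
move=> /(_ x) [t [_ tx]]; apply: contra_neq => E0; apply: le_anti.
by move: tx; rewrite E0 scaler0 oppr0 andbC.
Qed.

(** A one-sided radius. Negative t are allowed, so that - E gets a gauge at most -1, which later
    normalises the character at E. *)
Definition gauge E x : R := inf [set ratr t | t in [set t | (x <= t *: E)%O]].

Section OrderUnit.
Context {E : F} (E_unit : order_unit E) (E_neq0 : E != 0).

Let E_ge0 : ((0 : F) <= E)%O := order_unit_ge0 E_unit.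

Lemma gauge_le t x : (x <= t *: E)%O -> gauge E x <= ratr t.
Proof.
move=> xt; apply: ge_inf; last by exists t.
(* The set is bounded below: - uE <= x <= vE forces - u <= v, as E is nonnegative and nonzero. *)
have [u [_ /andP[ux _]]] := E_unit x; exists (ratr (- u)) => _ [v /= xv <-].
rewrite ler_rat; apply: (oplus_scale_le_inv E_ge0 E_neq0).
by rewrite scaleNr; exact: le_trans ux xv.
Qed.

Lemma le_gauge (c : R) x :
  (forall t, (x <= t *: E)%O -> c <= ratr t) -> c <= gauge E x.
Proof.
move=> cx; apply: lb_le_inf; last by move=> _ [t xt <-]; exact: cx.
by have [t [_ /andP[_ xt]]] := E_unit x; exists (ratr t), t.
Qed.

Lemma gauge_adherent x (e : R) : 0 < e ->
  exists2 t, (x <= t *: E)%O & ratr t < gauge E x + e.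
Proof.
move=> e0; have [||_ [t xt <-] lt_t] :=
  @inf_lt R [set ratr t | t in [set t | (x <= t *: E)%O]] (gauge E x + e).
- by have [t [_ /andP[_ xt]]] := E_unit x; exists (ratr t), t.
- by rewrite ltrDl.
- by exists t.
Qed.

Lemma gauge_max_sublinear : max_sublinear (gauge E).
Proof.
have gaugeD x y : gauge E (x + y) <= gauge E x + gauge E y.
  apply/ler_addgt0Pr => e e0; have e20 : 0 < e / 2 by rewrite divr_gt0.
  have [t xt te] := gauge_adherent x e20.
  have [u yu ue] := gauge_adherent y e20.
  apply: (@le_trans _ _ (ratr (t + u))).
    by apply: gauge_le; rewrite scalerDl oplus_leD.
  by rewrite rmorphD [e]splitr addrACA ltW // ltrD.
split=> // [x y|n x]; apply/eqP; rewrite eq_le.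
- apply/andP; split; last first.
    rewrite ge_max; apply/andP; split; apply: le_gauge => t;
    by rewrite -joinEoplus leUx => /andP[xt yt]; exact: gauge_le.
  apply/ler_addgt0Pr => e e0.
  have [t xt te] := gauge_adherent x e0.
  have [u yu ue] := gauge_adherent y e0.
  apply: (@le_trans _ _ (ratr (Num.max t u))).
    apply: gauge_le; rewrite -joinEoplus leUx.
    rewrite (le_trans xt) ?(le_trans yu) ?oplus_ler_wpZ2r //;
    by rewrite le_max lexx ?orbT.
  rewrite addr_maxl; have [_|_] := leP t u.
    by rewrite le_max (ltW ue) orbT.
  by rewrite le_max (ltW te).
- apply/andP; split.
    elim: n => // n IHn; rewrite mulrS [leRHS]mulrS.
    by apply: le_trans (gaugeD _ _) _; rewrite lerD2l.
  (* Inequalities can be divided by n+1: if (n+1)x <= tE then x <= (t/(n+1))E. *)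
  apply: le_gauge => t xt; rewrite -mulr_natr -ler_pdivlMr ?ltr0n //.
  have -> : ratr t / n.+1%:R = ratr (t / n.+1%:R) :> R.
    by rewrite fmorph_div rmorph_nat.
  apply: gauge_le; rewrite mulrC -scalerA.
  rewrite -[x](scalerK (a := n.+1%:R : rat)) ?pnatr_eq0 //.
  by apply: oplus_ler_wpZ2l; rewrite ?invr_ge0 ?ler0n // scaler_nat.
Qed.

Lemma radiusE x : radius R E x = Num.max (gauge E x) (gauge E (- x)).
Proof.
apply/eqP; rewrite eq_le; apply/andP; split.
- apply/ler_addgt0Pr => e e0.
  have [t xt te] := gauge_adherent x e0.
  have [u xu ue] := gauge_adherent (- x) e0.
  pose v := Num.max t u.
  have xv : (x <= v *: E)%O.
    by apply: le_trans xt _; rewrite oplus_ler_wpZ2r // le_max lexx.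
  have Nxv : (- x <= v *: E)%O.
    by apply: le_trans xu _; rewrite oplus_ler_wpZ2r // le_max lexx orbT.
  apply: (@le_trans _ _ (ratr v)).
    apply: ge_inf; first by exists 0 => _ [w [w0 _] <-]; rewrite ler0q.
    exists v => //; split; last by rewrite xv andbT -oplus_leN2 opprK.
    (* The radius only admits nonnegative scalars; adding x <= vE and - x <= vE gives 0 <= 2vE. *)
    have : 0 <= v + v.
      apply: (oplus_scale_le_inv E_ge0 E_neq0).
      by rewrite scale0r scalerDl -(subrr x) oplus_leD.
    by rewrite -mulr2n pmulrn_lge0.
  rewrite addr_maxl le_max /v; have [_|_] := leP t u.
    by rewrite (ltW ue) orbT.
  by rewrite (ltW te).
- apply: lb_le_inf.
    by have [t tx] := E_unit x; exists (ratr t), t.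
  move=> _ [t [_ /andP[tx xt]] <-]; rewrite ge_max !gauge_le //.
  by rewrite -oplus_leN2 opprK.
Qed.

End OrderUnit.
End Gauge.

(** * A normalised character attaining the radius *)

Theorem theorem4 (R : realType) (F : perfectSemifieldType) (E : F)
    (F_nontrivial : exists Y : F, Y != 0)
    (E_unit : forall Y : F, exists t : rat,
      0 <= t /\ (- (t *: E) <= Y <= t *: E)%O)
    (radius_eq0 : forall Y : F, radius R E Y = 0 <-> Y = 0)
    (N : F -> R) (N_norm : is_Fnorm E N) (N_complete : Fnorm_complete N)
    (X : F) (X_neq0 : X != 0) :
  exists2 phi : F -> R,
    normalized_characters R E phi & `|phi X| = radius R E X.
Proof.
have E_neq0 : E != 0 := order_unit_neq0 E_unit X_neq0.
have gaugeP := @gauge_max_sublinear R F E E_unit E_neq0.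
have r_ge0 : 0 <= radius R E X.
  apply: lb_le_inf; last by move=> _ [t [t0 _] <-]; rewrite ler0q.
  by have [t tX] := E_unit X; exists (ratr t), t.
(* The radius is the gauge of X or of - X; the sign is absorbed by the absolute value at the end. *)
have [Y [YX gY]] : exists Y, (Y = X \/ Y = - X) /\ gauge E Y = radius R E X.
  rewrite radiusE //; have [_|_] := leP (gauge E X) (gauge E (- X)).
    by exists (- X); split=> //; right.
  by exists X; split=> //; left.
have [phi [phi_max phiD phi_le phiY]] := exists_additive_minorant Y gaugeP.
have phi0 : phi 0 = 0 by apply: (@addrI _ (phi 0)); rewrite -phiD !addr0.
have phiN x : phi (- x) = - phi x.
  by apply: (@addrI _ (phi x)); rewrite -phiD !subrr.
(* Domination by the gauge at E and at - E bounds phi E above and below by 1. *)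
have phiE : phi E = 1.
  apply/eqP; rewrite eq_le -[1 <= _]lerN2 -phiN; apply/andP; split.
    apply: le_trans (phi_le _) _; rewrite -(rmorph1 (@ratr R)).
    by apply: gauge_le; rewrite ?scale1r.
  apply: le_trans (phi_le _) _; rewrite -(rmorphN1 (@ratr R)).
  by apply: gauge_le; rewrite ?scaleN1r.
exists phi.
  split=> //; split=> //; exists E.
  by rewrite phiE oner_neq0.
have -> : `|phi X| = `|phi Y| by case: YX => ->; rewrite ?phiN ?normrN.
by rewrite phiY gY ger0_norm.
Qed.
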